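(* Assume that the environment law $P$ on $\mathbb{Z}^d$, $d\ge2$, is iid, balanced and uniformly elliptic, and let $\ell\in S^{d-1}$ be a fixed direction. Then for $P$-almost every $\omega$ and for any $t\ge1$, $$\lim_{\lambda\to0^+}E_{\omega^\lambda}\frac{X_{t/\lambda^2}}{t/\lambda}=D_\ell .$$
   Context: Let $V=\{v\in\mathbb{Z}^d:|v|\le 1\}$, $\mathcal{M}$ the space of probability measures on $V$, $\Omega=\mathcal{M}^{\mathbb{Z}^d}$, $P$ a probability measure on $\Omega$. For $\omega=\{\omega(x,v)\}\in\Omega$, $(X_n)$ under the quenched law $P_\omega^x$ is the Markov chain with $X_0=x$ and $P_\omega^x(X_{n+1}=y+v\mid X_n=y)=\omega(y,v)$, $v\in V$; $E_\omega$ is expectation under $P_\omega=P_\omega^o$, $o$ the origin. For real $t\ge 0$, $X_t$ is defined by linear interpolation between $X_{\lfloor t\rfloor}$ and $X_{\lfloor t\rfloor+1}$. iid: the vectors $(\omega(x,e))_{|e|=1}$, $x\in\mathbb{Z}^d$, are iid under $P$. Balanced: $P\{\omega(x,e_i)=\omega(x,-e_i)\ \forall i,x\}=1$. Uniformly elliptic: for some $\kappa>0$, $P\{\omega(x,e)>\kappa\ \forall |e|=1,\forall x\}=1$. For $\lambda\in(0,1)$ the perturbed environment is $\omega^\lambda(x,e)=(1+\lambda\,\ell\cdot e)\,\omega(x,e)$. It is known (Lawler) that for $P$-a.e. $\omega$, under $P_\omega^o$ the process $(\lambda X_{t/\lambda^2})_{t\ge0}$ converges weakly as $\lambda\to0$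 to a Brownian motion with a non-degenerate deterministic diagonal covariance matrix $\bm{D}$. Here $D_\ell:=\bm{D}\ell=(2E_Q[\omega(o,e_i)]\ell_i)_{1\le i\le d}$, where $Q$ is the invariant ergodic probability measure, mutually absolutely continuous with $P$, of the Markov chain $\bar\omega(n)=\theta^{X_n}\omega$ on $\Omega$ ($\theta^y$ being the spatial shift). *)

(* Defs.v *)
From HB Require Import structures.
From mathcomp Require Import all_boot all_order all_algebra.
From mathcomp Require Import all_classical all_reals all_analysis.

Set Implicit Arguments.
Unset Strict Implicit.
Unset Printing Implicit Defensive.

Import Order.TTheory GRing.Theory Num.Theory.
Import numFieldNormedType.Exports.

Local Open Scope classical_set_scope.
Local Open Scope ring_scope.

HB.instance Definition _ := isPointed.Build int (0 : int).

Notation Zd d := 'rV[int]_d.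

(* [Vstep d] indexes the 2d+1 vectors of {v in Z^d : |v| <= 1}: [None] is 0,
   [Some (i, true)] is e_i and [Some (i, false)] is -e_i, so that the unit
   vectors e (|e| = 1) are indexed by [dir d].  See [stepv_inj], [stepvP]. *)
Notation dir d := ('I_d * bool)%type.
Notation Vstep d := (option (dir d)).

Definition stepv d (v : Vstep d) : Zd d :=
  if v is Some (i, b) then (if b then 1 else -1) *: delta_mx 0 i else 0.

Lemma stepv_inj d : injective (@stepv d).
Proof.
have E i b (j : 'I_d) :
    stepv (Some (i, b)) 0 j = if j == i then if b then 1 else -1 else 0.
  by rewrite /stepv !mxE eqxx /=; case: (j == i); rewrite ?mulr1 ?mulr0.
have N i b : stepv (Some (i, b)) <> stepv (@None (dir d)).
  by move=> /rowP /(_ i); rewrite E eqxx mxE; case: b.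
move=> [[i b]|] [[j c]|] //; last 2 first.
- by move/N.
- by move/esym/N.
move=> /rowP /(_ i); rewrite !E eqxx.
by case: (eqVneq i j) => [-> |_]; case: b; case: c.
Qed.

Lemma stepvP d (z : Zd d) :
  reflect (exists v : Vstep d, z = stepv v) (\sum_i z 0 i ^+ 2 <= 1).
Proof.
apply: (iffP idP) => [z1|[[[i b]|] ->]]; last first.
- by rewrite big1 // => i _; rewrite mxE expr0n.
- rewrite (bigD1 i) //= big1 ?addr0; last first.
    by move=> j /negbTE ji; rewrite !mxE eqxx ji mulr0 expr0n.
  by rewrite !mxE !eqxx mulr1; case: b.
have [z0|] := boolP [forall i, z 0 i == 0].
  by exists None; apply/rowP => i; rewrite mxE; apply/eqP/(forallP z0).
rewrite negb_forall => /existsP[i zi].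
have sq1 (a : int) : a != 0 -> 1 <= a ^+ 2.
  by move=> a0; rewrite -gtz0_ge1 exprn_even_gt0 //= a0.
move: z1; rewrite (bigD1 i) //= => z1.
have s0 (P : pred 'I_d) : 0 <= \sum_(j | P j) z 0 j ^+ 2.
  by apply: sumr_ge0 => j _; exact: sqr_ge0.
have zj j : j != i -> z 0 j = 0.
  move=> ji; apply/eqP; apply: contraT => zj0.
  move: z1; rewrite (bigD1 j) //= => z1.
  have := lerD (sq1 _ zi)
    (lerD (sq1 _ zj0) (s0 (fun k => (k != i) && (k != j)))).
  by move=> /le_trans /(_ z1); rewrite addr0.
have zi1 : z 0 i ^+ 2 == 1.
  rewrite eq_le sq1 // andbT; apply: le_trans z1; rewrite lerDl; exact: s0.
move: zi1; rewrite sqrf_eq1 => /orP[]/eqP zi1.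
- exists (Some (i, true)); apply/rowP => j; rewrite !mxE eqxx /=.
  by have [->|/zj->] := eqVneq j i; rewrite ?mulr1 ?mulr0.
- exists (Some (i, false)); apply/rowP => j; rewrite !mxE eqxx /=.
  by have [->|/zj->] := eqVneq j i; rewrite ?mulr1 ?mulr0.
Qed.

Section environment.
Variables (R : realType) (d : nat).

(* The space M: a probability measure on the finite set V is given by its
   mass function. *)
Definition pmf : Type :=
  {p : {ffun Vstep d -> R} | [forall v, 0 <= p v] && (\sum_v p v == 1)}.

Let mass0 : {ffun Vstep d -> R} := [ffun v => (v == None)%:R].

Fact pmf_point_subproof :
  [forall v, 0 <= mass0 v] && (\sum_v mass0 v == 1).
Proof.
apply/andP; split; first by apply/forallP => v; rewrite ffunE ler0n.
rewrite (bigD1 None) //= ffunE eqxx big1 ?addr0 // => v /negbTE vN.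
by rewrite ffunE vN.
Qed.

HB.instance Definition _ := Choice.on pmf.
HB.instance Definition _ :=
  isPointed.Build pmf (exist _ mass0 pmf_point_subproof).

Definition mass (p : pmf) (v : Vstep d) : R := sval p v.

Definition env_cylinders : set (set (Zd d -> pmf)) :=
  [set [set w | B (mass (w xv.1) xv.2)] |
     xv in [set: Zd d * Vstep d] & B in @measurable _ R].

(* Omega = M^(Z^d) with its product sigma-algebra. *)
Definition env : measurableType env_cylinders.-sigma :=
  g_sigma_algebraType env_cylinders.

Definition weight (w : env) (x : Zd d) (v : Vstep d) : R := mass (w x) v.

Definition site_cylinders : set (set (dir d -> R)) :=
  [set [set f | B (f e)] | e in [set: dir d] & B in @measurable _ R].

Definition site_space : measurableType site_cylinders.-sigma :=
  g_sigma_algebraType site_cylinders.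

(* The vector (w(x, e))_{|e| = 1}. *)
Definition site (x : Zd d) (w : env) : site_space :=
  fun e => weight w x (Some e).

Definition iid (P : probability env R) : Prop :=
  (forall (x y : Zd d) (A : set site_space), measurable A ->
     P (site x @^-1` A) = P (site y @^-1` A)) /\
  (forall (s : seq (Zd d)) (A : Zd d -> set site_space),
     uniq s -> (forall x, measurable (A x)) ->
     P [set w | forall x, x \in s -> A x (site x w)] =
     (\prod_(x <- s) P (site x @^-1` A x))%E).

Definition balanced (P : probability env R) : Prop :=
  P [set w | forall (x : Zd d) (i : 'I_d),
       weight w x (Some (i, true)) = weight w x (Some (i, false))] = 1%E.

Definition uniformly_elliptic (P : probability env R) : Prop :=
  exists2 kappa : R, 0 < kappa &
    P [set w | forall (x : Zd d) (e : dir d), kappa < weight w x (Some e)]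
    = 1%E.

Definition shift (y : Zd d) (w : env) : env := fun x => w (x + y).

(* Transition probability of the chain n |-> theta^(X_n) w on Omega. *)
Definition env_kernel (w : env) (A : set env) : \bar R :=
  (\sum_(v : Vstep d) (weight w 0%R v)%:E * \d_(shift (stepv v) w) A)%E.

Definition env_invariant (Q : probability env R) : Prop :=
  forall A : set env, measurable A -> Q A = (\int[Q]_w env_kernel w A)%E.

(* Ergodicity of the stationary chain with kernel [env_kernel]: its invariant
   events are trivial. *)
Definition env_ergodic (Q : probability env R) : Prop :=
  forall A : set env, measurable A ->
    {ae Q, forall w, env_kernel w A = (\1_A w)%:E} -> Q A = 0%E \/ Q A = 1%E.

Definition D_ell (Q : probability env R) (l : 'rV[R]_d) : 'rV[R]_d :=
  \row_i (2 * fine ('E_Q[fun w => weight w 0%R (Some (i, true))])%E * l 0 i).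

(* w^lambda; only for balanced w are the weights guaranteed to sum to 1, hence
   the result is a family of weights rather than an element of [env]. *)
Definition perturb (lambda : R) (l : 'rV[R]_d) (w : env) :
    Zd d -> Vstep d -> R :=
  fun x v => (1 + lambda * \sum_i l 0 i * (stepv v 0 i)%:~R) * weight w x v.

Definition trajectory_cylinders : set (set (nat -> Zd d)) :=
  [set [set X | X nx.1 = nx.2] | nx in [set: nat * Zd d]].

(* Trajectories (X_n), with the product of the discrete sigma-algebras. *)
Definition trajectory : measurableType trajectory_cylinders.-sigma :=
  g_sigma_algebraType trajectory_cylinders.

(* [Pr] is the law of the Markov chain started at [x] that jumps from [y] to
   [y + v] with probability [p y v]; the Markov property is multiplied out by
   the probability of the conditioning event. *)
Definition quenched_law (p : Zd d -> Vstep d -> R) (x : Zd d)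
    (Pr : probability trajectory R) : Prop :=
  Pr [set X : trajectory | X 0%N = x] = 1%E /\
  forall (n : nat) (h : nat -> Zd d) (v : Vstep d),
    Pr [set X : trajectory | (forall k, (k <= n)%N -> X k = h k) /\
                             X n.+1 = h n + stepv v] =
    (Pr [set X : trajectory | forall k, (k <= n)%N -> X k = h k]
      * (p (h n) v)%:E)%E.

(* X_s for real s >= 0, by linear interpolation. *)
Definition interp (X : trajectory) (s : R) : 'rV[R]_d :=
  let n := Num.truncn s in
  let toR := map_mx (fun z : int => z%:~R) in
  (1 - (s - n%:R)) *: toR (X n) + (s - n%:R) *: toR (X n.+1).

Definition vexpectation (Pr : probability trajectory R)
    (Y : trajectory -> 'rV[R]_d) : 'rV[R]_d :=
  \row_i fine ('E_Pr[fun X => Y X 0%R i])%E.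

End environment.

Arguments env : clear implicits.
Arguments trajectory : clear implicits.

(* Main.v *)
(* The drift of the perturbed walk at [x] in direction [e_i] is
   [2 lambda l_i w(x, e_i)], so the theorem is a law of large numbers, on the time
   scale [t / lambda^2], for the averages of [f(theta^x w) = w(x, e_i)] along the
   perturbed walk.  Let [M] and [M_lambda] be the transition operators of the
   unperturbed and perturbed walks and put [g = f - E_Q f].
   - Cauchy-Schwarz and balancedness give
     [(M_lambda^k r)^2 <= (1 + lambda^2)^k M^k (r^2)], and [(1 + lambda^2)^k <= e^t]
     for [k <= t / lambda^2].
   - [g = (h - M h) + r_m] with [h] bounded and [r_m = (1/m) sum_(k < m) M^k g].  The
     averages of [h - M h] along [M_lambda] are [O(lambda)], and those of [r_m] are
     controlled by the averages of [r_m^2] along [M].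
   - By the pointwise ergodic theorem for [M] the latter converge to [E_Q r_m^2] for
     [Q]-almost every [w], and [E_Q r_m^2] tends to 0 as [m] tends to infinity. *)
Require Import Defs.
From mathcomp Require Import all_boot all_order all_algebra.
From mathcomp Require Import all_classical all_reals all_analysis.
From mathcomp Require Import measurable_realfun ring lra.
Import Order.TTheory GRing.Theory Num.Theory.
Import numFieldNormedType.Exports.
Local Open Scope classical_set_scope.
Local Open Scope ring_scope.

Set Implicit Arguments.
Unset Strict Implicit.
Unset Printing Implicit Defensive.

(** * Averaging operators *)

Section markov_operator.
Context {R : realType} {T : Type} {V : finType}.
Variables (p : V -> T -> R) (tau : V -> T -> T).

(** The Markov operator of the kernel moving [x] to [tau v x] with probability [p v x]. One
    definition serves both the walk on Z^d and the environment chain. *)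
Definition avg (f : T -> R) : T -> R := fun x => \sum_v p v x * f (tau v x).

Definition psum (n : nat) (f : T -> R) : T -> R :=
  fun x => \sum_(k < n) iter k avg f x.

Lemma avgD f g : avg (f \+ g) = avg f \+ avg g.
Proof.
apply/funext => x; rewrite /avg /= -big_split /=; apply: eq_bigr => v _.
by rewrite mulrDr.
Qed.

Lemma avgZ c f : avg (c \*o f) = c \*o avg f.
Proof.
apply/funext => x; rewrite /avg /= mulr_sumr; apply: eq_bigr => v _.
by rewrite mulrCA.
Qed.

Lemma avg_sum n (f : 'I_n -> T -> R) :
  avg (fun x => \sum_i f i x) = (fun x => \sum_i avg (f i) x).
Proof.
apply/funext => x; rewrite /avg exchange_big; apply: eq_bigr => v _ /=.
by rewrite mulr_sumr.
Qed.

Lemma iter_avgD k f g : iter k avg (f \+ g) = iter k avg f \+ iter k avg g.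
Proof. by elim: k => // k IH; rewrite !iterS IH avgD. Qed.

Lemma iter_avgZ k c f : iter k avg (c \*o f) = c \*o iter k avg f.
Proof. by elim: k => // k IH; rewrite !iterS IH avgZ. Qed.

Lemma psumD n f g : psum n (f \+ g) = psum n f \+ psum n g.
Proof.
apply/funext => x; rewrite /psum /= -big_split /=.
by apply: eq_bigr => k _; rewrite iter_avgD.
Qed.

Lemma psumZ n c f : psum n (c \*o f) = c \*o psum n f.
Proof.
apply/funext => x; rewrite /psum /= mulr_sumr.
by apply: eq_bigr => k _; rewrite iter_avgZ.
Qed.

Lemma psumS n f : psum n.+1 f = f \+ avg (psum n f).
Proof.
by apply/funext => x; rewrite /psum big_ord_recl avg_sum.
Qed.

Lemma psumSr n f x : psum n.+1 f x = psum n f x + iter n avg f x.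
Proof. by rewrite /psum big_ord_recr. Qed.

(** The telescoping identity [psum n f - M (psum n f) = f - M^n f], the source of approximate
    solutions to the Poisson equation. *)
Lemma avg_psum n f x : avg (psum n f) x = psum n f x - f x + iter n avg f x.
Proof. by have := psumSr n f x; rewrite psumS /=; lra. Qed.

Hypothesis p_ge0 : forall v x, 0 <= p v x.
Hypothesis p_sum1 : forall x, \sum_v p v x = 1.

Lemma avg_cst c : avg (cst c) = cst c.
Proof.
by apply/funext => x; rewrite /avg /= -mulr_suml p_sum1 mul1r.
Qed.

Lemma iter_avg_cst k c : iter k avg (cst c) = cst c.
Proof. by elim: k => // k IH; rewrite iterS IH avg_cst. Qed.

Lemma psum_cst n c x : psum n (cst c) x = n%:R * c.
Proof.
rewrite /psum (eq_bigr (fun=> c)) => [|k _]; last by rewrite iter_avg_cst.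
by rewrite sumr_const card_ord mulr_natl.
Qed.

Lemma avg_le f g : (forall x, f x <= g x) -> forall x, avg f x <= avg g x.
Proof. by move=> fg x; apply: ler_sum => v _; exact: ler_wpM2l. Qed.

Lemma iter_avg_le k f g : (forall x, f x <= g x) ->
  forall x, iter k avg f x <= iter k avg g x.
Proof. by move=> fg; elim: k => // k IH; exact: avg_le. Qed.

Lemma iter_avg_ge0 k f : (forall x, 0 <= f x) -> forall x, 0 <= iter k avg f x.
Proof.
by move=> f0 x; have := iter_avg_le k (f := cst 0) f0 x; rewrite iter_avg_cst.
Qed.

Lemma iter_avg_norm_le k f g : (forall x, `|f x| <= g x) ->
  forall x, `|iter k avg f x| <= iter k avg g x.
Proof.
move=> fg; elim: k => // k IH x; rewrite !iterS.
apply: (le_trans (ler_norm_sum _ _ _)); apply: ler_sum => v _.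
by rewrite normrM ger0_norm // ler_wpM2l.
Qed.

Lemma iter_avg_bound k f C : (forall x, `|f x| <= C) ->
  forall x, `|iter k avg f x| <= C.
Proof.
by move=> fC x; have := iter_avg_norm_le k (g := cst C) fC x; rewrite iter_avg_cst.
Qed.

Lemma avg_bound f C : (forall x, `|f x| <= C) -> forall x, `|avg f x| <= C.
Proof. exact: (@iter_avg_bound 1). Qed.

Lemma psum_bound n f C : (forall x, `|f x| <= C) ->
  forall x, `|psum n f x| <= n%:R * C.
Proof.
move=> fC x; apply: (le_trans (ler_norm_sum _ _ _)).
rewrite -[n in n%:R]card_ord mulr_natl -sumr_const.
by apply: ler_sum => k _; exact: iter_avg_bound.
Qed.

End markov_operator.

(** * Bounded measurable functions and the ergodic theorem *)

Section bounded_measurable.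
Context {disp : measure_display} {T : measurableType disp} {R : realType}.

Definition bounded_measurable (f : T -> R) : Prop :=
  measurable_fun setT f /\ exists C, forall x, `|f x| <= C.

Lemma bounded_measurable_cst c : bounded_measurable (cst c).
Proof. by split; [exact: measurable_cst | exists `|c|]. Qed.

Lemma bounded_measurableD f g : bounded_measurable f -> bounded_measurable g ->
  bounded_measurable (f \+ g).
Proof.
move=> [mf [C fC]] [mg [D gD]]; split; first exact: measurable_funD.
by exists (C + D) => x; rewrite (le_trans (ler_normD _ _)) // lerD.
Qed.

Lemma bounded_measurableM f g : bounded_measurable f -> bounded_measurable g ->
  bounded_measurable (f \* g).
Proof.
move=> [mf [C fC]] [mg [D gD]]; split; first exact: measurable_funM.
by exists (C * D) => x; rewrite normrM ler_pM.
Qed.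

Lemma bounded_measurableZ c f :
  bounded_measurable f -> bounded_measurable (c \*o f).
Proof. exact: bounded_measurableM (bounded_measurable_cst c). Qed.

Lemma bounded_measurable_sum (I : Type) (s : seq I) (f : I -> T -> R) :
  (forall i, bounded_measurable (f i)) ->
  bounded_measurable (fun x => \sum_(i <- s) f i x).
Proof.
move=> mf; elim: s => [|i s IH].
  rewrite (_ : (fun _ => _) = cst 0); first exact: bounded_measurable_cst.
  by apply/funext => x; rewrite big_nil.
rewrite (_ : (fun _ => _) = f i \+ fun x => \sum_(i <- s) f i x).
  exact: bounded_measurableD.
by apply/funext => x; rewrite big_cons.
Qed.

Lemma bounded_measurable_max0 f : bounded_measurable f ->
  bounded_measurable (fun x => Num.max 0 (f x)).
Proof.
move=> [mf [C fC]]; split.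
  by apply: measurable_maxr => //; exact: measurable_cst.
exists C => x; apply: le_trans (fC x); rewrite /Num.max; case: ifP => //.
by rewrite normr0.
Qed.

Lemma bounded_measurable_indic (A : set T) :
  measurable A -> bounded_measurable (\1_A : T -> R).
Proof.
move=> mA; split; first exact: measurable_indic.
by exists 1 => x; rewrite indicE; case: (x \in A); rewrite ?normr1 ?normr0.
Qed.

Variable Q : probability T R.

Lemma bounded_measurable_integrable f :
  bounded_measurable f -> Q.-integrable setT (EFin \o f).
Proof.
move=> [mf [C fC]]; apply: measurable_bounded_integrable => //.
  by rewrite /= -ge0_fin_numE // fin_num_measure.
exists C; split; first exact: num_real.
by move=> r Cr x _ /=; rewrite (le_trans (fC x)) // ltW.
Qed.

Lemma Rintegral_probability_cst c : \int[Q]_x c = c.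
Proof.
rewrite Rintegral_cst // (_ : fine _ = 1) ?mulr1 //.
exact: (congr1 fine (probability_setT Q)).
Qed.

Lemma bounded_cvg_Rintegral (f_ : nat -> T -> R) f C :
  (forall n, measurable_fun setT (f_ n)) -> bounded_measurable f ->
  (forall n x, `|f_ n x| <= C) ->
  {ae Q, forall x, f_ ^~ x @ \oo --> f x} ->
  \int[Q]_x f_ n x @[n --> \oo] --> \int[Q]_x f x.
Proof.
move=> mf_ bf fC cvf.
have iC : Q.-integrable setT (EFin \o cst C).
  exact/bounded_measurable_integrable/bounded_measurable_cst.
have [] := @dominated_convergence _ _ _ Q setT measurableT
  (fun n => EFin \o f_ n) (EFin \o f) (EFin \o cst C).
- by move=> n; exact/measurable_EFinP.
- by apply/measurable_EFinP; case: bf.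
- by apply: filterS cvf => x cvx _; apply: cvg_EFin; [exact: nearW | exact: cvx].
- exact: iC.
- by apply: aeW => x n _ /=; rewrite lee_fin.
move=> _ _ cv; rewrite /Rintegral; apply: fine_cvg => //.
by rewrite fineK //; apply: integrable_fin_num => //;
  exact: bounded_measurable_integrable.
Qed.

Lemma Rintegral_ae_eq0 f : bounded_measurable f -> (forall x, 0 <= f x) ->
  \int[Q]_x f x = 0 -> {ae Q, forall x, f x = 0}.
Proof.
move=> bf f0 if0.
have : (\int[Q]_x `|(EFin \o f) x| = 0)%E.
  under eq_integral do rewrite gee0_abs ?lee_fin //.
  have /= := if0; rewrite /Rintegral => {}if0.
  rewrite -[LHS]fineK ?if0 //.
  by apply: integrable_fin_num => //; exact: bounded_measurable_integrable.
move/ae_eq_integral_abs => /(_ measurableT).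
have mf : measurable_fun setT (EFin \o f) by apply/measurable_EFinP; case: bf.
by move=> /(_ mf); apply: filterS => x /(_ I) /= [].
Qed.

Lemma Rintegral_indic (A : set T) : measurable A ->
  \int[Q]_x (\1_A x) = fine (Q A).
Proof. by move=> mA; rewrite /Rintegral integral_indic // setIT. Qed.

End bounded_measurable.

(** * The pointwise ergodic theorem for an ergodic stationary Markov operator *)

Section ergodic.
Context {disp : measure_display} {T : measurableType disp} {R : realType}.
Variables (V : finType) (p : V -> T -> R) (tau : V -> T -> T).
Variable Q : probability T R.
Hypothesis mp : forall v, measurable_fun setT (p v).
Hypothesis mtau : forall v, measurable_fun setT (tau v).
Hypothesis p_ge0 : forall v x, 0 <= p v x.
Hypothesis p_sum1 : forall x, \sum_v p v x = 1.

Lemma bounded_measurable_avg f :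
  bounded_measurable f -> bounded_measurable (avg p tau f).
Proof.
move=> [mf [C fC]]; split; last by exists C; exact: avg_bound.
apply: measurable_sum => v; apply: measurable_funM => //.
exact: measurableT_comp.
Qed.

Lemma bounded_measurable_iter_avg k f :
  bounded_measurable f -> bounded_measurable (iter k (avg p tau) f).
Proof. by move=> bf; elim: k => // k IH; exact: bounded_measurable_avg. Qed.

Lemma bounded_measurable_psum n f :
  bounded_measurable f -> bounded_measurable (psum p tau n f).
Proof.
by move=> bf; apply: bounded_measurable_sum => k; exact: bounded_measurable_iter_avg.
Qed.

Hypothesis Qinv : forall A, measurable A ->
  \int[Q]_x avg p tau \1_A x = \int[Q]_x (\1_A x).

Import HBSimple HBNNSimple.

(** Invariance is known on events; linearity gives simple functions, increasing approximation with
    bounded convergence gives nonnegative ones, and adding the constant [C] reduces the general case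
    to these. *)
Lemma Rintegral_avg f : bounded_measurable f ->
  \int[Q]_x avg p tau f x = \int[Q]_x f x.
Proof.
pose H f := bounded_measurable f /\ \int[Q]_x avg p tau f x = \int[Q]_x f x.
have HD g h : H g -> H h -> H (g \+ h).
  move=> [bg ig] [bh ih]; split; first exact: bounded_measurableD.
  rewrite avgD /= !RintegralD // ?ig ?ih //; apply: bounded_measurable_integrable => //;
  exact: bounded_measurable_avg.
have HZ c g : H g -> H (c \*o g).
  move=> [bg ig]; split; first exact: bounded_measurableZ.
  rewrite avgZ /= !RintegralZl // ?ig //; apply: bounded_measurable_integrable => //;
  exact: bounded_measurable_avg.
have Hcst c : H (cst c).
  by split; [exact: bounded_measurable_cst | rewrite avg_cst].
have Hsimple (h : {nnsfun T >-> R}) : H h.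
  rewrite (_ : (h : T -> R) = fun x =>
      \sum_(y <- finmap.enum_fset (fset_set (range h))) y * \1_(h @^-1` [set y]) x).
    elim: (finmap.enum_fset _) => [|y s IH].
      rewrite (_ : (fun _ => _) = cst 0) //.
      by apply/funext => x; rewrite big_nil.
    rewrite (_ : (fun _ => _) = (y \*o \1_(h @^-1` [set y])) \+
       (fun x => \sum_(i <- s) i * \1_(h @^-1` [set i]) x)).
      apply: HD => //; apply: HZ; split; first exact: bounded_measurable_indic.
      exact: Qinv.
    by apply/funext => x; rewrite big_cons.
  by apply/funext => x; rewrite fimfunE fsbig_finite.
have Hnn g : bounded_measurable g -> (forall x, 0 <= g x) -> H g.
  move=> bg g0; split => //; have [mg [C gC]] := bg.
  have mEg : measurable_fun setT (EFin \o g) by exact/measurable_EFinP.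
  pose h := nnsfun_approx measurableT mEg.
  have hg n x : h n x <= g x.
    have := @le_approx _ T R setT (EFin \o g) n x.
    rewrite -(nnsfun_approxE measurableT mEg) lee_fin; apply => //.
    by move=> y _; rewrite lee_fin.
  have hC n x : `|h n x| <= C.
    rewrite ger0_norm; last exact: fun_ge0.
    exact: le_trans (hg n x) (le_trans (ler_norm _) (gC x)).
  have cvh x : h ^~ x @ \oo --> g x.
    apply: (@fine_cvg _ _ _ _ (EFin \o (h ^~ x))).
    by apply: cvg_nnsfun_approx => // y _; rewrite lee_fin.
  have cv1 : \int[Q]_x h n x @[n --> \oo] --> \int[Q]_x g x.
    by apply: (@bounded_cvg_Rintegral _ _ _ _ _ _ C) => //; exact: aeW.
  have cv2 : \int[Q]_x avg p tau (h n) x @[n --> \oo] --> \int[Q]_x avg p tau g x.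
    apply: (@bounded_cvg_Rintegral _ _ _ _ _ _ C).
    - by move=> n; have [] := bounded_measurable_avg (Hsimple (h n)).1.
    - exact: bounded_measurable_avg.
    - by move=> n; apply: avg_bound => // x.
    - apply: aeW => x; rewrite /avg.
      apply: cvg_big => [|v _]; last exact: cvgMr.
      exact: add_continuous.
  have E : (fun n => \int[Q]_x avg p tau (h n) x) = (fun n => \int[Q]_x h n x).
    by apply/funext => n; have [] := Hsimple (h n).
  rewrite E in cv2; exact: (cvg_unique _ cv2 cv1).
move=> bf; have [_ [C fC]] := bf.
suff [] : H f by [].
rewrite (_ : f = (f \+ cst C) \+ cst (- C)).
  apply: HD => //; apply: Hnn.
    exact/bounded_measurableD/bounded_measurable_cst.
  by move=> x /=; have := fC x; rewrite ler_norml; lra.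
by apply/funext => x /=; ring.
Qed.

Hypothesis Qerg : forall A, measurable A ->
  {ae Q, forall x, avg p tau \1_A x = \1_A x} -> Q A = 0%E \/ Q A = 1%E.

(* The optimal value of [psum] stopped within [n] steps; unlike a running maximum of
   [psum], it satisfies an exact recursion [G_(n+1) = max 0 (f + M G_n)]. *)
Fixpoint stopping_value (f : T -> R) (n : nat) : T -> R :=
  if n is n'.+1 then fun x => Num.max 0 (f x + avg p tau (stopping_value f n') x)
  else cst 0.

Lemma bounded_measurable_stopping_value f n :
  bounded_measurable f -> bounded_measurable (stopping_value f n).
Proof.
move=> bf; elim: n => [|n IH] /=; first exact: bounded_measurable_cst.
exact/bounded_measurable_max0/bounded_measurableD/bounded_measurable_avg.
Qed.

Lemma stopping_value_ge0 f n x : 0 <= stopping_value f n x.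
Proof. by case: n => //= n; rewrite le_max lexx. Qed.

Lemma stopping_valueS f n x : stopping_value f n x <= stopping_value f n.+1 x.
Proof.
elim: n x => [|n IH] x; first exact: stopping_value_ge0.
rewrite [leLHS]/= [leRHS]/= ge_max le_max lexx /= le_max; apply/orP; right.
by rewrite lerD2l; exact: avg_le.
Qed.

Lemma stopping_value_le f m n x : (m <= n)%N ->
  stopping_value f m x <= stopping_value f n x.
Proof.
move=> /subnK <-; elim: (n - m)%N => // k IH.
exact: le_trans IH (stopping_valueS _ _ _).
Qed.

(** Running all [n] steps is one admissible stopping rule. *)
Lemma psum_le_stopping_value f n x : psum p tau n f x <= stopping_value f n x.
Proof.
elim: n x => [|n IH] x; first by rewrite /psum big_ord0.
rewrite psumS /= le_max; apply/orP; right.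
by rewrite lerD2l; exact: avg_le.
Qed.

(* On the set [E] where the stopping values diverge, [G_(n+1) - M G_n] is eventually
   [f]; its integral is [int (G_(n+1) - G_n) >= 0].  As [M 1_E <= 1_E], the set [E]
   is invariant, so [Q E = 1] would force [int f >= 0]. *)
Lemma psum_bounded_above f : bounded_measurable f -> \int[Q]_x f x < 0 ->
  {ae Q, forall x, exists C, forall n, psum p tau n f x <= C}.
Proof.
move=> bf intf; have [mf [C fC]] := bf.
have bv n := bounded_measurable_stopping_value n bf.
pose E := \bigcap_(k in [set: nat]) \bigcup_(n in [set: nat])
  [set x | k%:R < stopping_value f n x].
have mE : measurable E.
  apply: bigcap_measurable => // k _; apply: bigcup_measurable => n _.
  rewrite -[X in measurable X]setTI.
  rewrite -preimage_itvoy; apply: (bv n).1 => //; exact: measurable_itv.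
(* Divergence propagates backwards: if a move of positive probability leads from [x] into [E], the
   recursion forces [x] into [E]. *)
have avgE x : avg p tau \1_E x <= \1_E x.
  rewrite [leRHS]indicE; have [_|xE] := boolP (x \in E).
    have := @avg_le _ _ _ p tau p_ge0 \1_E (cst 1).
    rewrite avg_cst //; apply => y.
    by rewrite indicE /=; case: (_ \in _).
  rewrite /avg big1 // => v _; rewrite indicE.
  have [vE|_] := boolP (_ \in _); last by rewrite mulr0.
  rewrite mulr1; apply/eqP; apply: contraNT xE => pv; rewrite inE => k _.
  have pv0 : 0 < p v x by rewrite lt0r pv p_ge0.
  (* Beyond this threshold [p v x * stopping_value f n (tau v x)] exceeds [k + C], which absorbs
     [f x >= - C]. *)
  move: vE; rewrite inE => /(_ (Num.truncn ((k%:R + C) / p v x)).+1 I)[n _ /=].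
  move/(lt_trans (truncnS_gt _)); rewrite ltr_pdivrMr // => ltn.
  exists n.+1 => //=; rewrite lt_max; apply/orP; right.
  have : p v x * stopping_value f n (tau v x) <= avg p tau (stopping_value f n) x.
    rewrite /avg (bigD1 v) //= lerDl sumr_ge0 // => u _.
    by rewrite mulr_ge0 // stopping_value_ge0.
  by have := fC x; rewrite ler_norml => /andP[]; lra.
have b1 : bounded_measurable (\1_E : T -> R) by exact: bounded_measurable_indic.
have b2 := bounded_measurable_avg b1.
(* The difference [1_E - M 1_E] is nonnegative, and its integral is 0 by invariance. *)
have aeE : {ae Q, forall x, avg p tau \1_E x = \1_E x}.
  have b3 : bounded_measurable (\1_E \+ -1 \*o avg p tau \1_E).
    exact/bounded_measurableD/bounded_measurableZ.
  have b30 x : 0 <= (\1_E \+ -1 \*o avg p tau \1_E) x :> R.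
    by have := avgE x => /=; lra.
  have : \int[Q]_x (\1_E \+ -1 \*o avg p tau \1_E) x = 0.
    rewrite RintegralD // ?RintegralZl //; last 3 first.
    - exact: bounded_measurable_integrable.
    - exact: bounded_measurable_integrable.
    - exact/bounded_measurable_integrable/bounded_measurableZ.
    by rewrite Qinv // mulN1r subrr.
  move/(Rintegral_ae_eq0 b3 b30) => /=.
  by apply: filterS => x; lra.
have [QE|QE] := Qerg mE aeE.
  exists E; split => // x /= nx; apply: contrapT => /existsNP[k].
  move=> /not_implyP[_ nk]; apply: nx; exists k%:R => n.
  apply: le_trans (psum_le_stopping_value _ _ _) _.
  by rewrite leNgt; apply/negP => kn; apply: nk; exists n.
pose D n x := stopping_value f n.+1 x - avg p tau (stopping_value f n) x.
have bD n : bounded_measurable (D n).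
  rewrite (_ : D n = stopping_value f n.+1 \+ -1 \*o avg p tau (stopping_value f n)).
    by apply: bounded_measurableD => //; exact/bounded_measurableZ/bounded_measurable_avg.
  by apply/funext => x; rewrite /D /=; ring.
(* With [a = M G_n x >= 0], either [D n x = f x], or the maximum is 0, in which case [f x + a <= 0]
   and [D n x = - a] lies between [f x] and 0. *)
have DC n x : `|D n x| <= C.
  have a0 : 0 <= avg p tau (stopping_value f n) x.
    by have := iter_avg_ge0 tau p_ge0 p_sum1 1 (stopping_value_ge0 f n) x.
  have := fC x; rewrite /D /= /Num.max; case: ifPn => [|]; rewrite -?leNgt.
    by move=> _; rewrite addrK.
  move: a0; set a := avg _ _ _ _ => a0 fa; rewrite !ler_norml; lra.
have cvD : {ae Q, forall x, D ^~ x @ \oo --> f x}.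
  exists (~` E); split; first exact: measurableC.
    by rewrite probability_setC // QE subee.
  move=> x /=; apply: contra_not => xE.
  (* Once some stopping value is positive, all later ones are, so the maximum with 0 is no longer
     active. *)
  have [n _ /= n0] := xE 0%N I.
  apply: cvg_near_cst; exists n => // m /= nm.
  have := lt_le_trans n0 (stopping_value_le f x (leq_trans nm (leqnSn m))).
  rewrite /D /= lt_max ltxx /= => /ltW/max_idPr ->.
  by rewrite addrK.
have := bounded_cvg_Rintegral (fun n => (bD n).1) bf DC cvD.
move=> /cvgr_to_ge => /(_ 0); rewrite leNgt intf /= => H.
suff : false by []; apply: H; apply: nearW => n.
rewrite RintegralB //; last 2 first.
- exact: bounded_measurable_integrable.
- exact/bounded_measurable_integrable/bounded_measurable_avg.
rewrite Rintegral_avg // subr_ge0; apply: le_Rintegral => //.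
- exact: bounded_measurable_integrable.
- exact: bounded_measurable_integrable.
- by move=> x _; exact: stopping_valueS.
Qed.

(** The functions [f - c - e] and [c - f - e] have integral [- e < 0], so their partial sums are
    bounded above almost everywhere; dividing by [n] puts the averages asymptotically within [e] of
    [c]. *)
Theorem ergodic_average f : bounded_measurable f ->
  {ae Q, forall x, psum p tau n f x / n%:R @[n --> \oo] --> \int[Q]_x f x}.
Proof.
move=> bf; set c := \int[Q]_x f x.
(* The sign [s] treats both one-sided bounds at once; tolerances [1 / (k + 1)] leave only countably
   many null sets. *)
have H s k : `|s| = 1 -> {ae Q, forall x, exists C, forall n,
    s * (psum p tau n f x - n%:R * c) <= n%:R * k.+1%:R^-1 + C}.
  move=> s1; pose e := k.+1%:R^-1 : R.
  have e0 : 0 < e by rewrite invr_gt0.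
  pose g := (s \*o f) \+ cst (- s * c - e).
  have bs : bounded_measurable (s \*o f) by exact: bounded_measurableZ.
  have bc := @bounded_measurable_cst _ T R (- s * c - e).
  have bg : bounded_measurable g by exact: bounded_measurableD.
  have ig : \int[Q]_x g x < 0.
    rewrite RintegralD //; try exact: bounded_measurable_integrable.
    rewrite RintegralZl //; try exact: bounded_measurable_integrable.
    by rewrite Rintegral_probability_cst -/c; lra.
  apply: filterS (psum_bounded_above bg ig) => x [C HC]; exists C => n.
  by have := HC n; rewrite psumD psumZ /= psum_cst //; rewrite -/e; lra.
have H1 k := H 1 k (normr1 _).
have HN1 k := H (-1) k (normrN1 _).
apply: filterS2 (ae_foralln H1) (ae_foralln HN1) => x {}H1 {}HN1.
apply/cvgrPdist_le => e e0.
have [k ke] : exists k, k.+1%:R^-1 < e / 2.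
  exists (Num.truncn (e / 2)^-1); rewrite invf_plt ?posrE ?divr_gt0 //.
  exact: truncnS_gt.
have [C1 HC1] := H1 k; have [C2 HC2] := HN1 k.
near=> n.
have n0 : (0 : R) < n%:R by near: n; exact: nbhs_infty_gtr.
have C1n : C1 / (e / 2) < n%:R by near: n; exact: nbhs_infty_gtr.
have C2n : C2 / (e / 2) < n%:R by near: n; exact: nbhs_infty_gtr.
move: C1n C2n; rewrite !ltr_pdivrMr ?divr_gt0 // => C1n C2n.
have := HC1 n; have := HC2 n => h2 h1.
have kn : n%:R * k.+1%:R^-1 < n%:R * (e / 2) by rewrite ltr_pM2l.
rewrite ler_norml -(ler_pM2r n0) -[_ <= e](ler_pM2r n0) mulrBl divfK ?gt_eqF //.
move: h1 h2 kn C1n C2n; move: (n%:R) (psum _ _ _ _ _) (_^-1) => y S z.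
nra.
Unshelve. all: by end_near. Qed.

End ergodic.

(** * Tilted kernels *)

Section tilted_kernel.
Context {R : realType} {T : Type} {V : finType}.
Variables (p : V -> T -> R) (tau : V -> T -> T) (s : V -> R).

Definition tilt (lambda : R) : V -> T -> R := fun v x => (1 + lambda * s v) * p v x.

Hypothesis p_ge0 : forall v x, 0 <= p v x.
Hypothesis p_sum1 : forall x, \sum_v p v x = 1.
Hypothesis s_le1 : forall v, `|s v| <= 1.
Hypothesis p_centered : forall x, \sum_v s v * p v x = 0.

Lemma tilt_ge0 lambda v x : 0 < lambda < 1 -> 0 <= tilt lambda v x.
Proof.
move=> /andP[l0 l1]; rewrite mulr_ge0 //.
by have := s_le1 v; rewrite ler_norml; nra.
Qed.

Lemma tilt_sum1 lambda x : \sum_v tilt lambda v x = 1.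
Proof.
rewrite /tilt (eq_bigr (fun v => p v x + lambda * (s v * p v x))).
  by rewrite big_split /= -mulr_sumr p_sum1 p_centered mulr0 addr0.
by move=> v _; ring.
Qed.

Lemma avg_tilt lambda f x : avg (tilt lambda) tau f x =
  avg p tau f x + lambda * \sum_v s v * p v x * f (tau v x).
Proof.
rewrite /avg mulr_sumr -big_split /=; apply: eq_bigr => v _.
by rewrite /tilt; ring.
Qed.

(** Cauchy-Schwarz for [f] and [1 + lambda * s] under the weights [p v x]. Centering kills the term
    linear in [lambda], so the second moment [A] of the density is at most [1 + lambda ^+ 2]. *)
Lemma avg_tilt_sqr lambda f x :
  (avg (tilt lambda) tau f x) ^+ 2 <=
  (1 + lambda ^+ 2) * avg p tau (fun y => f y ^+ 2) x.
Proof.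
set B := avg p _ _ x; set C := avg _ _ _ x.
pose A := \sum_v p v x * (1 + lambda * s v) ^+ 2.
have EA : A = 1 + lambda ^+ 2 * \sum_v p v x * s v ^+ 2.
  rewrite /A (eq_bigr (fun v => p v x + (2 * lambda) * (s v * p v x) +
     lambda ^+ 2 * (p v x * s v ^+ 2))); last by move=> v _; ring.
  rewrite !big_split /= -!mulr_sumr p_sum1 p_centered; ring.
have s2 : 0 <= \sum_v p v x * s v ^+ 2 <= 1.
  rewrite sumr_ge0 /=; last by move=> v _; rewrite mulr_ge0 // sqr_ge0.
  rewrite -(p_sum1 x); apply: ler_sum => v _.
  by rewrite ler_piMr // -real_normK ?num_real // expr_le1.
have l2 : 0 <= lambda ^+ 2 by exact: sqr_ge0.
have B0 : 0 <= B by apply: sumr_ge0 => v _; rewrite mulr_ge0 // sqr_ge0.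
(* The Cauchy-Schwarz gap times [A] is a weighted sum of squares; [A >= 1] allows division by
   [A]. *)
have : 0 <= A * (A * B - C ^+ 2).
  rewrite (_ : _ * _ = \sum_v p v x * (A * f (tau v x) - C * (1 + lambda * s v)) ^+ 2).
    by apply: sumr_ge0 => v _; rewrite mulr_ge0 // sqr_ge0.
  rewrite (eq_bigr (fun v => A ^+ 2 * (p v x * f (tau v x) ^+ 2)
      + (- 2 * A * C) * (tilt lambda v x * f (tau v x))
      + C ^+ 2 * (p v x * (1 + lambda * s v) ^+ 2))); last first.
    by move=> v _; rewrite /tilt; ring.
  rewrite !big_split /= -!mulr_sumr -[\sum_v p v x * f _ ^+ 2]/B.
  rewrite -[\sum_v tilt _ _ _ * _]/C -/A; ring.
have A1 : 1 <= A by rewrite EA; nra.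
have A2 : A <= 1 + lambda ^+ 2 by rewrite EA; nra.
rewrite pmulr_rge0; last lra.
by rewrite subr_ge0 => /le_trans; apply; exact: ler_wpM2r.
Qed.

Lemma iter_avg_tilt_sqr lambda k f x :
  (iter k (avg (tilt lambda) tau) f x) ^+ 2 <=
  (1 + lambda ^+ 2) ^+ k * iter k (avg p tau) (fun y => f y ^+ 2) x.
Proof.
elim: k x => [|k IH] x; first by rewrite expr0 mul1r.
have l2 : 0 <= 1 + lambda ^+ 2 by rewrite addr_ge0 // sqr_ge0.
rewrite !iterS (le_trans (avg_tilt_sqr _ _ _)) // [_ ^+ k.+1]exprS -mulrA ler_wpM2l //.
have := avg_le tau p_ge0 IH x.
by rewrite (avgZ p tau ((1 + lambda ^+ 2) ^+ k)).
Qed.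

(* Poisson-equation splitting: with [h] the Cesaro mean of the first partial sums,
   [g = (h - avg h) + (psum m g) / m]; the coboundary telescopes along the tilted
   kernel up to the tilt, and the second term is controlled through its square. *)
Lemma psum_tilt_le lambda delta C m n g x :
  0 < lambda < 1 -> 0 < delta -> (0 < m)%N -> (forall y, `|g y| <= C) ->
  `|psum (tilt lambda) tau n g x| <=
  2 * m%:R * C + n%:R * (lambda * m%:R * C) + n%:R * delta / 2 +
  (1 + lambda ^+ 2) ^+ n / (2 * delta) *
    psum p tau n (fun y => (psum p tau m g y / m%:R) ^+ 2) x.
Proof.
move=> lam delta0 m0 gC; set q := tilt lambda.
have [lam0 lam1] := andP lam.
have q0 v y : 0 <= q v y by exact: tilt_ge0.
have q1 y : \sum_v q v y = 1 by exact: tilt_sum1.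
have m0R : (0 : R) < m%:R by rewrite ltr0n.
have C0 : 0 <= C by rewrite (le_trans _ (gC x)).
pose r y := psum p tau m g y / m%:R.
pose h := m%:R^-1 \*o (fun y => \sum_(k < m) psum p tau k g y).
have hC y : `|h y| <= m%:R * C.
  rewrite /h /= normrM ger0_norm ?invr_ge0 ?ler0n // mulrC ler_pdivrMr //.
  apply: (le_trans (ler_norm_sum _ _ _)).
  rewrite [leRHS](_ : _ = \sum_(k < m) m%:R * C); last first.
    by rewrite sumr_const card_ord mulr_natr.
  apply: ler_sum => k _; apply: (le_trans (psum_bound tau p_ge0 p_sum1 k gC y)).
  by rewrite ler_wpM2r // ler_nat ltnW.
(* Each [psum k g] contributes [g - M^k g] to [h - M h]; the mean over [k < m] is [g - r]. *)
have gE y : g y = h y - avg p tau h y + r y.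
  rewrite /h avgZ avg_sum /= [X in _ - _ * X](eq_bigr (fun k : 'I_m =>
    psum p tau k g y - g y + iter k (avg p tau) g y)); last first.
    by move=> k _; exact: avg_psum.
  rewrite big_split /= sumrB sumr_const card_ord -/(psum p tau m g y) /r -mulr_natl.
  by field; rewrite gt_eqF.
(* Since [avg q h = avg p h + lambda * b], replacing the kernel in the coboundary costs only
   [lambda * b]. *)
pose b y := \sum_v s v * p v y * h (tau v y).
have bC y : `|b y| <= m%:R * C.
  apply: (le_trans (ler_norm_sum _ _ _)).
  rewrite [leRHS](_ : _ = \sum_v p v y * (m%:R * C)); last first.
    by rewrite -mulr_suml p_sum1 mul1r.
  apply: ler_sum => v _; rewrite normrM; apply: ler_pM => //.
  by rewrite normrM (ger0_norm (p_ge0 v y)) ler_piMl.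
have -> : psum q tau n g x = (h x - iter n (avg q tau) h x) +
    lambda * psum q tau n b x + psum q tau n r x.
  have {1}-> : g = ((h \+ -1 \*o avg q tau h) \+ lambda \*o b) \+ r.
    by apply/funext => z; rewrite /= gE avg_tilt -/(b z); ring.
  rewrite !psumD (psumZ _ _ n (-1)) (psumZ _ _ n lambda) /=; congr (_ + _ + _).
  rewrite (_ : psum q tau n (avg q tau h) x = avg q tau (psum q tau n h) x).
    by rewrite avg_psum; ring.
  by rewrite /psum avg_sum; apply: eq_bigr => k _; rewrite -iterSr.
have e1 := hC x; have e2 := iter_avg_bound tau q0 q1 n hC x.
have e3 : `|lambda * psum q tau n b x| <= n%:R * (lambda * m%:R * C).
  rewrite normrM gtr0_norm // [leRHS](_ : _ = lambda * (n%:R * (m%:R * C))).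
    by rewrite ler_pM2l //; exact: psum_bound.
  by ring.
have e4 : `|psum q tau n r x| <= n%:R * delta / 2 +
    (1 + lambda ^+ 2) ^+ n / (2 * delta) * psum p tau n (fun y => r y ^+ 2) x.
  apply: (le_trans (ler_norm_sum _ _ _)).
  rewrite [X in _ <= X + _](_ : _ = \sum_(k < n) delta / 2); last first.
    by rewrite sumr_const card_ord -[RHS]mulr_natl mulrA.
  rewrite /psum mulr_sumr.
  rewrite -big_split /=; apply: ler_sum => k _.
  have := iter_avg_tilt_sqr lambda k r x; rewrite -/q.
  set a := iter k (avg q tau) r x; set a2 := iter k (avg p tau) _ x => aa2.
  have a20 : 0 <= a2 by apply: iter_avg_ge0 => // y; exact: sqr_ge0.
  have : (1 + lambda ^+ 2) ^+ k * a2 <= (1 + lambda ^+ 2) ^+ n * a2.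
    rewrite ler_wpM2r // ler_weXn2l ?lerDl ?sqr_ge0 //.
    exact: ltnW.
  move/(le_trans aa2); rewrite -real_normK ?num_real // => le_a.
  (* Young's inequality: [|a| <= delta / 2 + a ^+ 2 / (2 * delta)]. *)
  have : 0 <= (`|a| - delta) ^+ 2 by exact: sqr_ge0.
  rewrite sqrrB => h0.
  rewrite -(ler_pM2r (_ : 0 < 2 * delta)) ?mulr_gt0 // [leRHS]mulrDl.
  rewrite [X in _ <= _ + X](_ : _ = (1 + lambda ^+ 2) ^+ n * a2); last first.
    by field; rewrite gt_eqF.
  nra.
rewrite -[leRHS]addrA; apply: le_trans (ler_normD _ _) _; apply: lerD e4.
apply: le_trans (ler_normD _ _) _; apply: lerD e3.
apply: le_trans (ler_normB _ _) _; lra.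
Qed.

(** The order of choices matters: [m] is fixed first to make [I m] small, then [lambda] tends to 0.
    In the bound of [psum_tilt_le], scaled by [lambda ^+ 2 / t], the terms carrying [m * C] then
    vanish. *)
Lemma cvg_psum_tilt t C g x (I : nat -> R) :
  0 < t -> (forall y, `|g y| <= C) ->
  (forall m, psum p tau n (fun y => (psum p tau m g y / m%:R) ^+ 2) x / n%:R
     @[n --> \oo] --> I m) ->
  I m @[m --> \oo] --> 0 ->
  lambda ^+ 2 / t * psum (tilt lambda) tau (Num.truncn (t / lambda ^+ 2)) g x
    @[lambda --> 0^'+] --> 0.
Proof.
move=> t0 gC cvn cvm; apply/cvgrPdist_le => e e0.
have C0 : 0 <= C by rewrite (le_trans _ (gC x)).
pose K := expR t; have K0 : 0 < K by exact: expR_gt0.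
(* With [delta = e / 2], the quadratic term is at most [K / e * eta = e / 8] per step and
   [delta / 2 = e / 4], together [e * 3 / 8]. *)
pose eta := e ^+ 2 / (8 * K).
have eta0 : 0 < eta by rewrite divr_gt0 ?exprn_gt0 ?mulr_gt0.
have [m m0 Im] : exists2 m, (0 < m)%N & I m < eta.
  have /cvgrPdist_lt /(_ _ eta0) [N _ HN] := cvm.
  exists N.+1 => //; have := HN N.+1 (leqnSn N); rewrite /= sub0r normrN.
  exact: le_lt_trans (ler_norm _).
have /cvgrPdist_lt /(_ (eta - I m)) := cvn m.
rewrite subr_gt0 => /(_ Im) [N _ HN].
(* Bounding [lambda] and [lambda ^+ 2 / t] by [1 / a] makes each of them times [m * C] at most
   [e / 16]; the [+ 1] keeps [a] positive when [C = 0]. *)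
pose a := m%:R * C * 16 / e + 1.
have a0 : 0 < a by rewrite ltr_wpDl // divr_ge0 ?mulr_ge0 // ltW.
near=> lambda.
have l0 : 0 < lambda by [].
have l1 : lambda < 1 by near: lambda; exact: nbhs_right_lt.
(* As [lambda ^+ 2 <= lambda], this forces [t / lambda ^+ 2 >= N + 1], hence [N < n]. *)
have lN : lambda < t / N.+1%:R by near: lambda; apply: nbhs_right_lt; rewrite divr_gt0.
have la : lambda < a^-1 by near: lambda; apply: nbhs_right_lt; rewrite invr_gt0.
have lat : lambda < t / a by near: lambda; apply: nbhs_right_lt; rewrite divr_gt0.
set n := Num.truncn _.
have l20 : 0 < lambda ^+ 2 by rewrite exprn_gt0.
have ll : lambda ^+ 2 <= lambda by rewrite expr2 ger_pMl // ltW.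
have tl0 : 0 <= t / lambda ^+ 2 by rewrite divr_ge0 ?ltW.
have nle : n%:R <= t / lambda ^+ 2 by rewrite truncn_le.
have Nn : (N < n)%N.
  rewrite truncn_gt_nat ler_pdivlMr // mulrC -ler_pdivlMr // ltW //.
  exact: le_lt_trans lN.
have nR0 : (0 : R) < n%:R by rewrite ltr0n (leq_ltn_trans _ Nn).
have := HN n (ltnW Nn) => /=.
have lam : 0 < lambda < 1 by rewrite l0.
have e20 : 0 < e / 2 by rewrite divr_gt0.
have := @psum_tilt_le lambda (e / 2) C m n g x lam e20 m0 gC.
set S := psum (tilt _) _ _ _ _; set A := psum p _ _ _ _ => HS HA.
have {}HA : A / n%:R <= eta by move: HA; rewrite ltr_norml => /andP[]; lra.
have {}HA : A <= n%:R * eta by rewrite mulrC -ler_pdivrMr.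
(* Here [1 + y <= expR y] and [n * lambda ^+ 2 <= t]. *)
have HK : (1 + lambda ^+ 2) ^+ n <= K.
  apply: (@le_trans _ _ (expR (lambda ^+ 2) ^+ n)).
    by rewrite lerXn2r ?nnegrE ?expR_ge0 ?expR_ge1Dx // addr_ge0 ?ltW.
  rewrite -expRM_natl ler_expR -(ler_pM2r (_ : 0 < (lambda ^+ 2)^-1)) ?invr_gt0 //.
  by rewrite mulfK ?gt_eqF.
pose w := lambda ^+ 2 / t.
have w0 : 0 < w by rewrite divr_gt0.
have nw : n%:R * w <= 1.
  by rewrite mulrA ler_pdivrMr // mul1r -ler_pdivlMr.
have wa : w * a <= 1.
  by rewrite -ler_pdivlMr // mul1r ler_pdivrMr // mulrC (le_trans ll) // ltW.
have lla : lambda * a <= 1 by rewrite -ler_pdivlMr // mul1r ltW.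
have Ma : m%:R * C <= a * e / 16.
  rewrite (_ : a * e / 16 = m%:R * C + e / 16) ?lerDl ?divr_ge0 ?ltW //.
  by rewrite /a; field; rewrite gt_eqF.
have {}HS : `|S| <= 2 * (m%:R * C) + n%:R * (lambda * (m%:R * C)) + n%:R * (e * 3 / 8).
  apply: (le_trans HS).
  have : (1 + lambda ^+ 2) ^+ n / (2 * (e / 2)) * A <= n%:R * (e / 8).
    apply: (@le_trans _ _ (K / (2 * (e / 2)) * (n%:R * eta))).
      apply: ler_pM => //.
      - by rewrite divr_ge0 ?exprn_ge0 ?addr_ge0 ?mulr_ge0 ?sqr_ge0 // ltW.
      - by apply: sumr_ge0 => k _; apply: iter_avg_ge0 => // y; exact: sqr_ge0.
      - by rewrite ler_pM2r // invr_gt0 mulr_gt0.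
    rewrite /eta le_eqVlt; apply/orP; left; apply/eqP; field.
    by rewrite !gt_eqF.
  by rewrite -!mulrA; lra.
rewrite sub0r normrN normrM (gtr0_norm w0) -/w.
apply: (le_trans (ler_wpM2l (ltW w0) HS)).
set M := m%:R * C in Ma *.
have wM : w * M <= e / 16.
  apply: (le_trans (ler_wpM2l (ltW w0) Ma)).
  by move: wa lla; clear -e0; nra.
have lM : lambda * M <= e / 16.
  apply: (le_trans (ler_wpM2l (ltW l0) Ma)).
  by move: wa lla; clear -e0; nra.
have nwlM : (n%:R * w) * (lambda * M) <= e / 16.
  by apply: le_trans lM; rewrite ler_piMl // !mulr_ge0 // ltW.
have nwe : (n%:R * w) * (e * 3 / 8) <= e * 3 / 8.
  by rewrite ler_piMl // divr_ge0 ?mulr_ge0 // ltW.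
by lra.
Unshelve. all: by end_near. Qed.

End tilted_kernel.

(** * Finite-dimensional laws of the quenched chain *)

Section quenched.
Context {R : realType} {d : nat}.
Variables (p : Zd d -> Vstep d -> R) (x0 : Zd d) (Pr : probability (trajectory d) R).
Hypothesis Prq : quenched_law p x0 Pr.
Hypothesis p_sum1 : forall x, \sum_v p x v = 1.

(** Words grow at their right end, matching the Markov property in [quenched_law], which appends the
    last jump to a known past. *)
Fixpoint step_seqs (n : nat) : seq (seq (Vstep d)) :=
  if n is n'.+1 then [seq rcons s v | s <- step_seqs n', v <- index_enum (Vstep d)]
  else [:: [::]].

Definition walk (s : seq (Vstep d)) (k : nat) : Zd d :=
  x0 + \sum_(v <- take k s) stepv v.

Definition walk_cylinder (s : seq (Vstep d)) : set (trajectory d) :=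
  [set X | forall k, (k <= size s)%N -> X k = walk s k].

Lemma big_step_seqsS (n : nat) (F : seq (Vstep d) -> R) :
  \sum_(s <- step_seqs n.+1) F s = \sum_(s <- step_seqs n) \sum_v F (rcons s v).
Proof. by rewrite big_allpairs_dep. Qed.

Lemma size_step_seqs n s : s \in step_seqs n -> size s = n.
Proof.
elim: n s => [|n IH] s; first by rewrite inE => /eqP ->.
by move=> /allpairsP[[s' v]] [/IH sn _ ->]; rewrite size_rcons sn.
Qed.

Lemma walk_rcons s v k : (k <= size s)%N -> walk (rcons s v) k = walk s k.
Proof. by move=> ks; rewrite /walk -cats1 takel_cat. Qed.

Lemma walk_rconsS s v :
  walk (rcons s v) (size s).+1 = walk s (size s) + stepv v.
Proof.
by rewrite /walk -[X in take X (rcons _ _)](size_rcons s v) !take_size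
  -cats1 big_cat big_seq1 addrA.
Qed.

Lemma walk_cylinder_rcons s v : walk_cylinder (rcons s v) =
  [set X : trajectory d | (forall k, (k <= size s)%N -> X k = walk s k) /\
                          X (size s).+1 = walk s (size s) + stepv v].
Proof.
apply/seteqP; split => X /=.
  rewrite /walk_cylinder /= size_rcons => H; split.
    by move=> k ks; rewrite H ?(leq_trans ks) // walk_rcons.
  by rewrite H // walk_rconsS.
move=> [H1 H2] k; rewrite size_rcons leq_eqVlt => /orP[/eqP ->|].
  by rewrite H2 walk_rconsS.
by rewrite ltnS => ks; rewrite H1 // walk_rcons.
Qed.

(** Countability of Z^d turns an arbitrary [A] into a countable union of generating cylinders. *)
Lemma measurable_position (n : nat) (A : set (Zd d)) :
  measurable [set X : trajectory d | A (X n)].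
Proof.
have m1 z : measurable [set X : trajectory d | X n = z].
  by apply: sub_sigma_algebra; exists (n, z).
rewrite (_ : mkset _ = \bigcup_(z in A) [set X : trajectory d | X n = z]).
  rewrite bigcup_mkcond; apply: countable_bigcupT_measurable => // z.
  by case: ifP.
apply/seteqP; split => X /=; first by move=> AX; exists (X n).
by move=> [z Az /= ->].
Qed.

Lemma measurable_walk_cylinder s : measurable (walk_cylinder s).
Proof.
rewrite (_ : walk_cylinder s = \bigcap_(k in [set k | (k <= size s)%N])
    [set X : trajectory d | X k = walk s k]).
  by apply: bigcap_measurableType => k _; exact: (measurable_position k [set walk s k]).
by apply/seteqP; split => X H k /=; exact: H.
Qed.

Lemma quenched_cylinder_nil : fine (Pr (walk_cylinder [::])) = 1.
Proof.
rewrite (_ : walk_cylinder _ = [set X : trajectory d | X 0%N = x0]).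
  by case: Prq => ->.
apply/seteqP; split => X /=.
  by move=> /(_ 0%N isT); rewrite /walk big_nil addr0.
by move=> X0 k /=; rewrite leqn0 => /eqP ->; rewrite /walk big_nil addr0.
Qed.

Lemma quenched_cylinder_rcons s v : fine (Pr (walk_cylinder (rcons s v))) =
  fine (Pr (walk_cylinder s)) * p (walk s (size s)) v.
Proof.
rewrite walk_cylinder_rcons (Prq.2 (size s) (walk s) v) fineM //.
by rewrite fin_num_measure //; exact: measurable_walk_cylinder.
Qed.

(** Summing out the last jump replaces [f] by its one-step average, so induction identifies the law
    of [X_n] with powers of the transition operator, for arbitrary [f]. *)
Lemma quenched_sum n f :
  \sum_(s <- step_seqs n) f (walk s n) * fine (Pr (walk_cylinder s)) =
  iter n (avg (fun v x => p x v) (fun v x => x + stepv v)) f x0.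
Proof.
elim: n f => [|n IH] f.
  by rewrite big_seq1 quenched_cylinder_nil mulr1 /walk big_nil addr0.
rewrite iterSr -IH big_step_seqsS; apply: eq_big_seq => s /size_step_seqs sn.
rewrite /avg mulr_suml; apply: eq_bigr => v _.
by rewrite quenched_cylinder_rcons -sn walk_rconsS; ring.
Qed.

(** Consistency of the marginals, so that positions at times [n] and [n + 1] can both be summed over
    words of length [n + 1]. *)
Lemma quenched_sumS n f :
  \sum_(s <- step_seqs n.+1) f (walk s n) * fine (Pr (walk_cylinder s)) =
  \sum_(s <- step_seqs n) f (walk s n) * fine (Pr (walk_cylinder s)).
Proof.
rewrite big_step_seqsS; apply: eq_big_seq => s /size_step_seqs sn.
rewrite (eq_bigr (fun v => f (walk s n) * fine (Pr (walk_cylinder s))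
    * p (walk s n) v)).
  by rewrite -mulr_sumr p_sum1 mulr1.
move=> v _; rewrite quenched_cylinder_rcons walk_rcons ?sn //; ring.
Qed.

(** Distinct words have disjoint cylinders: by injectivity of [stepv], a trajectory in the cylinder
    of [s] follows at most one extension of [s]. *)
Lemma sum_indic_walk_cylinder_le1 n X :
  \sum_(s <- step_seqs n) \1_(walk_cylinder s) X <= 1 :> R.
Proof.
elim: n => [|n IH]; first by rewrite big_seq1 indicE lern1 leq_b1.
apply: le_trans IH; rewrite big_step_seqsS; apply: ler_sum => s _.
have [[v Xv]|nX] := pselect (exists v, X \in walk_cylinder (rcons s v)).
  rewrite (bigD1 v) //= big1 ?addr0.
    rewrite !indicE Xv; move: Xv; rewrite inE walk_cylinder_rcons => -[Xs _].
    by rewrite mem_set.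
  move=> u uv; rewrite indicE; case: (boolP (X \in _)) => // Xu.
  move: Xu Xv; rewrite !inE !walk_cylinder_rcons => -[_ eu] [_].
  by rewrite eu => /addrI /stepv_inj uv'; rewrite uv' eqxx in uv.
rewrite big1 ?indicE // => v _; rewrite indicE.
by case: (boolP (X \in _)) => // Xv; exfalso; apply: nX; exists v.
Qed.

Lemma sum_quenched_cylinder n : 
  \sum_(s <- step_seqs n) fine (Pr (walk_cylinder s)) = 1.
Proof.
have := quenched_sum n (cst 1); rewrite iter_avg_cst //=.
by under eq_bigr do rewrite mul1r.
Qed.

(** The disjoint cylinders have total mass 1, so they cover almost every trajectory; paths with a
    jump outside the range of [stepv] are negligible. *)
Lemma ae_sum_indic_walk_cylinder n :
  {ae Pr, forall X, \sum_(s <- step_seqs n) \1_(walk_cylinder s) X = 1 :> R}.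
Proof.
have b1 s : bounded_measurable (\1_(walk_cylinder s) : _ -> R).
  by apply: bounded_measurable_indic; exact: measurable_walk_cylinder.
have bs : bounded_measurable
    (fun X => \sum_(s <- step_seqs n) \1_(walk_cylinder s) X : R).
  exact: bounded_measurable_sum.
pose F := cst 1 \+ -1 \*o (fun X => \sum_(s <- step_seqs n) \1_(walk_cylinder s) X : R).
have bF : bounded_measurable F.
  by apply: bounded_measurableD (bounded_measurableZ _ _) => //;
    exact: bounded_measurable_cst.
have F0 X : 0 <= F X.
  by have := sum_indic_walk_cylinder_le1 n X; rewrite /F /=; lra.
have intsum r : \int[Pr]_X (\sum_(s <- r) \1_(walk_cylinder s) X) =
    \sum_(s <- r) fine (Pr (walk_cylinder s)).
  elim: r => [|s r IH].
    rewrite big_nil; under eq_Rintegral do rewrite big_nil.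
    exact: Rintegral_probability_cst.
  rewrite big_cons -IH; under eq_Rintegral do rewrite big_cons.
  rewrite RintegralD //; first by rewrite Rintegral_indic //; exact: measurable_walk_cylinder.
    exact: bounded_measurable_integrable.
  by apply: bounded_measurable_integrable; exact: bounded_measurable_sum.
have : \int[Pr]_X F X = 0.
  rewrite RintegralD //; last 2 first.
  - exact/bounded_measurable_integrable/bounded_measurable_cst.
  - exact/bounded_measurable_integrable/bounded_measurableZ.
  rewrite RintegralZl //; last exact: bounded_measurable_integrable.
  by rewrite Rintegral_probability_cst intsum sum_quenched_cylinder; lra.
move/(Rintegral_ae_eq0 bF F0); apply: filterS => X.
by rewrite /F /=; lra.
Qed.

(** Up to a null set [F] is a linear combination of cylinder indicators, which turns the Lebesgue
    integral into a finite sum. *)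
Lemma quenched_expectation n (F : trajectory d -> R) (G : seq (Vstep d) -> R) :
  measurable_fun setT F ->
  (forall s X, s \in step_seqs n -> walk_cylinder s X -> F X = G s) ->
  fine ('E_Pr[F])%E = \sum_(s <- step_seqs n) G s * fine (Pr (walk_cylinder s)).
Proof.
move=> mF FG; rewrite unlock.
have b1 s : bounded_measurable (G s \*o \1_(walk_cylinder s) : _ -> R).
  by apply: bounded_measurableZ; apply: bounded_measurable_indic;
    exact: measurable_walk_cylinder.
pose H X := \sum_(s <- step_seqs n) G s * \1_(walk_cylinder s) X.
have bH : bounded_measurable H by exact: bounded_measurable_sum b1.
rewrite (@ae_eq_integral _ _ _ _ setT (EFin \o H)) //; last 3 first.
- exact/measurable_EFinP.
- by apply/measurable_EFinP; case: bH.
- apply: filterS (ae_sum_indic_walk_cylinder n) => X X1 _ /=; congr EFin.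
  rewrite -[LHS]mulr1 -X1 mulr_sumr; apply: eq_big_seq => s sn.
  rewrite indicE; case: (boolP (X \in _)) => [|_]; last by rewrite !mulr0.
  by rewrite inE => /(FG _ _ sn) ->.
rewrite -/(Rintegral Pr setT H) /H; elim: (step_seqs n) => [|s r IH].
  rewrite big_nil; under eq_Rintegral do rewrite big_nil.
  exact: Rintegral_probability_cst.
rewrite big_cons -IH; under eq_Rintegral do rewrite big_cons.
rewrite RintegralD //; last 2 first.
- exact: bounded_measurable_integrable (b1 s).
- by apply: bounded_measurable_integrable; exact: bounded_measurable_sum b1.
rewrite RintegralZl // ?Rintegral_indic //; first exact: measurable_walk_cylinder.
apply: bounded_measurable_integrable; apply: bounded_measurable_indic.
exact: measurable_walk_cylinder.
Qed.

Lemma quenched_interpolation n c a b (f : Zd d -> R) :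
  fine ('E_Pr[fun X => (c * (a * f (X n) + b * f (X n.+1)))%R])%E =
  c * (a * iter n (avg (fun v x => p x v) (fun v x => x + stepv v)) f x0 +
       b * iter n.+1 (avg (fun v x => p x v) (fun v x => x + stepv v)) f x0).
Proof.
have mf k : measurable_fun setT (fun X : trajectory d => f (X k)).
  by move=> _ B mB; rewrite setTI; exact: (measurable_position k (f @^-1` B)).
rewrite (@quenched_expectation n.+1 _
  (fun s => c * (a * f (walk s n) + b * f (walk s n.+1)))); last 2 first.
- apply: measurable_funM; first exact: measurable_cst.
  by apply: measurable_funD; apply: measurable_funM => //; exact: measurable_cst.
- by move=> s X /size_step_seqs sn H; rewrite !H ?sn.
rewrite -!quenched_sum -quenched_sumS !mulr_sumr -big_split /= mulr_sumr.
by apply: eq_bigr => s _; ring.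
Qed.

End quenched.

(** * The environment seen from the walk *)

Local Notation shift := Defs.shift.
Local Notation env_avg := (avg (fun v w => weight w 0 v) (fun v => shift (stepv v))).
Local Notation env_psum := (psum (fun v w => weight w 0 v) (fun v => shift (stepv v))).
Local Notation walk_avg p := (avg (fun v x => p x v) (fun v x => x + stepv v)).
Local Notation walk_psum p := (psum (fun v x => p x v) (fun v x => x + stepv v)).

Section environment_chain.
Context {R : realType} {d : nat}.
Implicit Types (w : env R d).

Lemma weight_ge0 w x v : 0 <= weight w x v.
Proof. by rewrite /weight /mass; case: (w x) => m /= /andP[/forallP]. Qed.

Lemma weight_sum1 w x : \sum_v weight w x v = 1.
Proof. by rewrite /weight /mass; case: (w x) => m /= /andP[_ /eqP]. Qed.

Lemma weight_le1 w x v : weight w x v <= 1.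
Proof.
rewrite -(weight_sum1 w x) (bigD1 v) //= lerDl.
by apply: sumr_ge0 => u _; exact: weight_ge0.
Qed.

Lemma measurable_weight x v : measurable_fun setT (fun w => weight w x v).
Proof.
move=> _ B mB; rewrite setTI; apply: sub_sigma_algebra.
by exists (x, v) => //; exists B.
Qed.

Lemma measurable_shift y : measurable_fun setT (@shift R d y).
Proof.
apply: (@measurability _ _ (env R d) (env R d) _ _ (@env_cylinders R d)) => //.
move=> _ [_ [[x v] _ [B mB <-]] <-]; rewrite setTI.
have := @measurable_weight (x + y) v measurableT B mB.
by rewrite setTI.
Qed.

Lemma bounded_measurable_weight x v : bounded_measurable (fun w => weight w x v).
Proof.
split; first exact: measurable_weight.
by exists 1 => w; rewrite ger0_norm ?weight_ge0 ?weight_le1.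
Qed.

Lemma env_kernel_avg w A : env_kernel w A = (env_avg \1_A w)%:E.
Proof.
rewrite /env_kernel /avg -sumEFin; apply: eq_bigr => v _.
by rewrite EFinM diracE indicE.
Qed.

Lemma env_ergodic_average (Q : probability (env R d) R) (f : env R d -> R) :
  env_invariant Q -> env_ergodic Q -> bounded_measurable f ->
  {ae Q, forall w, env_psum n f w / n%:R
    @[n --> \oo] --> \int[Q]_x f x}.
Proof.
move=> hinv herg bf; apply: ergodic_average => //.
- by move=> v; exact: measurable_weight.
- by move=> v; exact: measurable_shift.
- by move=> v w; exact: weight_ge0.
- by move=> w; exact: weight_sum1.
- move=> A mA; rewrite Rintegral_indic // hinv // /Rintegral; congr fine.
  by apply: eq_integral => w _; rewrite env_kernel_avg.
- move=> A mA ae1; apply: herg => //; apply: filterS ae1 => w.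
  by rewrite env_kernel_avg => <-.
Qed.

(** The map [x |-> shift x w] intertwines the walk in [w] with the environment chain. *)
Lemma iter_avg_shift k (f : env R d -> R) w x :
  iter k (walk_avg (weight w))
    (fun y => f (shift y w)) x = iter k env_avg f (shift x w).
Proof.
elim: k x => //= k IH x; apply: eq_bigr => v _.
congr (_ * _); first by rewrite /weight /shift add0r.
rewrite IH; congr (iter k _ f _); apply/funext => y; rewrite /shift.
by rewrite -addrA [stepv v + x]addrC.
Qed.

Lemma psum_shift n (f : env R d -> R) w x :
  walk_psum (weight w) n
    (fun y => f (shift y w)) x =
  env_psum n f (shift x w).
Proof. by apply: eq_bigr => k _; exact: iter_avg_shift. Qed.

Lemma shift0 w : shift 0 w = w.
Proof. by apply/funext => x; rewrite /shift addr0. Qed.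

Lemma sum_stepv (i : 'I_d) (F : Vstep d -> R) :
  \sum_v (stepv v 0 i)%:~R * F v = F (Some (i, true)) - F (Some (i, false)).
Proof.
have tf : Some (i, false) != Some (i, true) :> Vstep d.
  by apply/eqP => -[].
rewrite (bigD1 (Some (i, true))) //= (bigD1 (Some (i, false))) //= big1.
  by rewrite !mxE !eqxx /= !mulr1 mul1r mulN1r addr0.
move=> [[j b]|]; last by rewrite mxE mul0r.
move=> /andP[n1 n2]; rewrite !mxE eqxx /=; case: eqVneq => [ij|]; last first.
  by rewrite mulr0 mul0r.
by subst j; case: b n1 n2; rewrite eqxx.
Qed.

(** The function [s] for which [perturb lambda l w] is the tilt of [weight w]. *)
Definition slope (l : 'rV[R]_d) (v : Vstep d) : R :=
  \sum_i l 0 i * (stepv v 0 i)%:~R.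

Lemma slope_dir (l : 'rV[R]_d) i b :
  slope l (Some (i, b)) = if b then l 0 i else - l 0 i.
Proof.
rewrite /slope (bigD1 i) //= big1 => [|j /negbTE ji].
  by rewrite !mxE !eqxx /= mulr1; case: b; rewrite ?mulr1 ?mulrN1 addr0.
by rewrite !mxE ji eqxx /= mulr0 mulr0.
Qed.

Lemma slope_norm_le1 (l : 'rV[R]_d) v : \sum_i l 0 i ^+ 2 = 1 -> `|slope l v| <= 1.
Proof.
move=> hl; case: v => [[i b]|]; last first.
  by rewrite /slope big1 ?normr0 // => i _; rewrite mxE mulr0.
rewrite slope_dir -(expr_le1 (n := 2)) // real_normK ?num_real //.
rewrite (_ : _ ^+ 2 = l 0 i ^+ 2); last by case: b; rewrite ?sqrrN.
rewrite -hl (bigD1 i) //= lerDl; apply: sumr_ge0 => j _; exact: sqr_ge0.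
Qed.

Definition balanced_at w := forall (x : Zd d) (i : 'I_d),
  weight w x (Some (i, true)) = weight w x (Some (i, false)).

(** The event is a countable intersection of equalities between measurable functions, so its
    complement is a measurable null set. *)
Lemma ae_balanced (P : probability (env R d) R) :
  balanced P -> {ae P, forall w, balanced_at w}.
Proof.
move=> hbal.
have mB : measurable [set w | balanced_at w].
  rewrite (_ : mkset _ = \bigcap_x \bigcap_i
    [set w | weight w x (Some (i, true)) = weight w x (Some (i, false))]).
    rewrite -[X in measurable X]setCK setC_bigcap; apply: measurableC.
    apply: countable_bigcupT_measurable => // x.
    rewrite setC_bigcap; apply: countable_bigcupT_measurable => // i.
    apply: measurableC.
    have m b := measurable_weight x (Some (i, b)).
    have := measurable_fun_eqr (m true) (m false) measurableT.
    move=> /(_ [set true] I); rewrite setTI.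
    by congr measurable; apply/seteqP; split => w /= /eqP.
  by apply/seteqP; split => w H; [move=> x _ i _; exact: H | move=> x i; exact: H].
exists (~` [set w | balanced_at w]); split => //; first exact: measurableC.
by rewrite probability_setC // [P _]hbal subee.
Qed.

Lemma slope_centered (l : 'rV[R]_d) w x : balanced_at w ->
  \sum_v slope l v * weight w x v = 0.
Proof.
move=> wb; under eq_bigr do rewrite mulr_suml.
rewrite exchange_big big1 //= => i _.
under eq_bigr do rewrite -mulrA.
by rewrite -mulr_sumr sum_stepv wb subrr mulr0.
Qed.

Lemma perturb_drift lambda (l : 'rV[R]_d) w x i : balanced_at w ->
  \sum_v (stepv v 0 i)%:~R * perturb lambda l w x v =
  2 * lambda * l 0 i * weight w x (Some (i, true)).
Proof.
move=> wb; rewrite sum_stepv /perturb -!/(slope l _) !slope_dir wb; ring.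
Qed.

(** One step of the perturbed walk adds its drift to the coordinate function; iterating gives the
    mean displacement as the accumulated mean drift. *)
Lemma perturb_position lambda (l : 'rV[R]_d) w n i : balanced_at w ->
  iter n (walk_avg (perturb lambda l w))
    (fun z => (z 0 i)%:~R) 0 =
  2 * lambda * l 0 i *
  walk_psum (perturb lambda l w) n
    (fun x => weight w x (Some (i, true))) 0.
Proof.
move=> wb; elim: n => [|n IH]; first by rewrite /psum big_ord0 mulr0 /= mxE.
rewrite iterSr psumSr mulrDr -IH.
have -> : walk_avg (perturb lambda l w)
    (fun z => (z 0 i)%:~R) = (fun z : Zd d => (z 0 i)%:~R) \+
      (2 * lambda * l 0 i) \*o (fun x => weight w x (Some (i, true))).
  apply/funext => x; rewrite /= -(perturb_drift _ _ _ _ wb).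
  transitivity (\sum_v (perturb lambda l w x v * (x 0 i)%:~R +
      (stepv v 0 i)%:~R * perturb lambda l w x v)).
    by apply: eq_bigr => v _; rewrite mxE intrD; ring.
  rewrite big_split /= -mulr_suml.
  have := tilt_sum1 (p := fun v x => weight w x v) (s := slope l)
    (weight_sum1 w) (fun y => slope_centered l y wb) lambda x.
  by rewrite /tilt /perturb => ->; rewrite mul1r.
by rewrite iter_avgD iter_avgZ.
Qed.

(** The ergodic theorem is used twice: for [f], where bounded convergence then gives
    [I m = E_Q r_m -> 0], and for every [r_m], on one common null set. The result is phrased on Z^d
    for a fixed [w], since there balancedness at every site supplies the centering that the tilt
    requires. *)
Lemma ae_average_square (Q : probability (env R d) R) (f : env R d -> R) :
  env_invariant Q -> env_ergodic Q -> bounded_measurable f ->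
  \int[Q]_x f x = 0 ->
  exists2 I : nat -> R, I m @[m --> \oo] --> 0 &
  {ae Q, forall w m, walk_psum (weight w) n
     (fun y => (walk_psum (weight w) m
         (fun y => f (shift y w)) y / m%:R) ^+ 2) 0 / n%:R
     @[n --> \oo] --> I m}.
Proof.
move=> hinv herg bf f0; have [mf [C fC]] := bf.
pose S n := env_psum n : (env R d -> R) -> _.
have bS m : bounded_measurable (S m f).
  apply: bounded_measurable_psum => //.
  - by move=> v; exact: measurable_weight.
  - by move=> v; exact: measurable_shift.
  - by move=> v w; exact: weight_ge0.
  - by move=> w; exact: weight_sum1.
pose r m w := (S m f w / m%:R) ^+ 2.
have br m : bounded_measurable (r m).
  have b1 : bounded_measurable (fun w => S m f w / m%:R).
    exact: bounded_measurableM (bS m) (bounded_measurable_cst _).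
  rewrite (_ : r m = (fun w => S m f w / m%:R) \* (fun w => S m f w / m%:R)).
    exact: bounded_measurableM.
  by apply/funext => w; rewrite /r expr2.
exists (fun m => \int[Q]_w r m w).
  have -> : 0 = \int[Q]_w (cst 0 w) :> R by rewrite Rintegral_probability_cst.
  apply: (@bounded_cvg_Rintegral _ _ _ _ _ _ (C ^+ 2)).
  - by move=> m; have [] := br m.
  - exact: bounded_measurable_cst.
  - move=> m w; rewrite ger0_norm ?sqr_ge0 // /r -real_normK ?num_real //.
    rewrite lerXn2r ?nnegrE //; first by rewrite (le_trans _ (fC w)).
    (* At [m = 0] the inverse is 0 by convention, so the bound holds trivially. *)
    have [->|m0] := eqVneq m 0%N.
      by rewrite invr0 mulr0 normr0 (le_trans _ (fC w)).
    rewrite normrM normfV [`|m%:R|]ger0_norm // ler_pdivrMr ?ltr0n ?lt0n //.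
    rewrite mulrC; apply: psum_bound => //.
    - by move=> v u; exact: weight_ge0.
    - by move=> u; exact: weight_sum1.
  - apply: filterS (env_ergodic_average hinv herg bf) => w.
    rewrite f0 => cv; have -> : cst 0 w = 0 * 0 :> R by rewrite mulr0.
    rewrite (_ : (fun m => r m w) = fun m => (S m f w / m%:R) * (S m f w / m%:R)).
      exact: (cvgM cv cv).
    by apply/funext => m; rewrite /r expr2.
have H m := env_ergodic_average hinv herg (br m).
apply: filterS (ae_foralln H) => w Hw m.
under eq_fun => n.
  rewrite (_ : walk_psum _ n _ 0 = env_psum n (r m) w); first over.
  rewrite -[in RHS](shift0 w) -psum_shift; congr (psum _ _ _ _ _).
  by apply/funext => y; rewrite /r psum_shift.
exact: Hw.
Qed.

End environment_chain.

(** * The rescaled mean displacement of the perturbed walk *)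

Section velocity.
Context {R : realType} {d : nat}.

Lemma cvg_row (T : Type) (F : set_system T) (FF : Filter F)
    (f : T -> 'rV[R]_d) (a : 'rV[R]_d) :
  (forall i, f x 0 i @[x --> F] --> a 0 i) -> f x @[x --> F] --> a.
Proof.
move=> fa; apply/cvg_ballP => e e0.
have : \forall x \near F, forall i, ball (a 0 i) e (f x 0 i).
  by apply: filter_forall => i; move/cvg_ballP : (fa i); apply.
by apply: filterS => x H; split => // j i; rewrite (ord1 j).
Qed.

(** Interpolation adds the fractional part of [t / lambda ^+ 2] times one more drift term. The
    factor [lambda] of the drift and the normalisation [lambda / t] combine into
    [lambda ^+ 2 / t]. *)
Lemma vexpectation_velocity (lambda t : R) (l : 'rV[R]_d) (w : env R d)
    (Pr : probability (trajectory d) R) i :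
  balanced_at w -> 0 < lambda -> 0 < t ->
  quenched_law (perturb lambda l w) 0 Pr ->
  let n := Num.truncn (t / lambda ^+ 2) in
  let u x := weight w x (Some (i, true)) in
  vexpectation Pr (fun X => (t / lambda)^-1 *: interp X (t / lambda ^+ 2)) 0 i =
  2 * l 0 i * (lambda ^+ 2 / t * (walk_psum (perturb lambda l w) n u 0 +
    (t / lambda ^+ 2 - n%:R) * iter n (walk_avg (perturb lambda l w)) u 0)).
Proof.
move=> wb l0 t0 hq n u; rewrite mxE.
have p1 x : \sum_v perturb lambda l w x v = 1.
  have := tilt_sum1 (p := fun v x => weight w x v) (s := slope l)
    (weight_sum1 w) (fun y => slope_centered l y wb) lambda x.
  by rewrite /tilt /perturb.
pose th := t / lambda ^+ 2 - n%:R.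
have := quenched_interpolation hq p1 n (t / lambda)^-1 (1 - th) th
  (fun z => (z 0 i)%:~R).
rewrite !perturb_position // psumSr -/u => E.
rewrite (_ : (fun X => _) = (fun X : trajectory d => (t / lambda)^-1 *
   ((1 - th) * (X n 0 i)%:~R + th * (X n.+1 0 i)%:~R))); last first.
  by apply/funext => X; rewrite /interp -/n -/th !mxE.
rewrite E -/th; field.
by rewrite !gt_eqF.
Qed.

(** Write [u = (u - c) + c]. The constant part, including the interpolated step, sums exactly to
    [c * t / lambda ^+ 2]; the centered sum vanishes by [cvg_psum_tilt]; the centered interpolation
    term is [O(lambda ^+ 2)]. *)
Lemma cvg_velocity (t : R) (l : 'rV[R]_d) (w : env R d) (c : R) (I : nat -> R)
    (Pw : R -> probability (trajectory d) R) i :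
  let u x := weight w x (Some (i, true)) in
  \sum_i l 0 i ^+ 2 = 1 -> balanced_at w -> 0 < t ->
  (forall lambda, 0 < lambda < 1 -> quenched_law (perturb lambda l w) 0 (Pw lambda)) ->
  (forall m, walk_psum (weight w) n (fun y => (walk_psum (weight w) m
      (fun x => u x - c) y / m%:R) ^+ 2) 0 / n%:R @[n --> \oo] --> I m) ->
  I m @[m --> \oo] --> 0 ->
  vexpectation (Pw lambda)
    (fun X => (t / lambda)^-1 *: interp X (t / lambda ^+ 2)) 0 i
    @[lambda --> 0^'+] --> 2 * c * l 0 i.
Proof.
move=> u hl wb t0 hq cvn cvm.
have u1 x : `|u x| <= 1 by rewrite ger0_norm ?weight_ge0 ?weight_le1.
have gC x : `|u x - c| <= 1 + `|c|.
  by rewrite (le_trans (ler_normB _ _)) // lerD2r.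
have := @cvg_psum_tilt _ _ _ _ (fun v (x : Zd d) => x + stepv v) (slope l)
  (fun v x => weight_ge0 w x v) (weight_sum1 w) (fun v => slope_norm_le1 v hl)
  (fun x => slope_centered l x wb) t _ _ 0 I t0 gC cvn cvm.
set F := (fun lambda => _ * psum _ _ _ _ _) => cv.
(* Chosen so that [|G lambda| <= lambda ^+ 2 * B]; the [+ 1] keeps [B] positive when [l 0 i = 0]. *)
pose B := 2 * `|l 0 i| * (1 + `|c|) / t + 1.
have B0 : 0 < B.
  by rewrite ltr_wpDl // divr_ge0 ?mulr_ge0 ?addr_ge0 // ltW.
pose G lambda := 2 * l 0 i * (lambda ^+ 2 / t *
  ((t / lambda ^+ 2 - (Num.truncn (t / lambda ^+ 2))%:R) *
   (iter (Num.truncn (t / lambda ^+ 2)) (walk_avg (perturb lambda l w)) u 0 - c))).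
have q0 lambda v x : 0 < lambda < 1 -> 0 <= perturb lambda l w x v.
  exact: (tilt_ge0 (p := fun v x => weight w x v) (fun v x => weight_ge0 w x v)
    (fun v => slope_norm_le1 v hl)).
have q1 lambda x : \sum_v perturb lambda l w x v = 1.
  exact: (tilt_sum1 (p := fun v x => weight w x v) (s := slope l)
    (weight_sum1 w) (fun y => slope_centered l y wb) lambda x).
have cvG : G lambda @[lambda --> 0^'+] --> 0.
  apply/cvgrPdist_le => e e0; near=> lambda.
  have l0 : 0 < lambda by [].
  have l1 : lambda < 1 by near: lambda; exact: nbhs_right_lt.
  have le : lambda < e / B by near: lambda; apply: nbhs_right_lt; rewrite divr_gt0.
  rewrite sub0r normrN /G; set n := Num.truncn _; set a := iter _ _ _ _.
  have a1 : `|a| <= 1.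
    by apply: iter_avg_bound => // v x; apply: q0; rewrite l0.
  have l20 : 0 < lambda ^+ 2 by rewrite exprn_gt0.
  have tl0 : 0 <= t / lambda ^+ 2 by rewrite divr_ge0 ?ltW.
  have /andP[n1] := truncn_itv tl0; rewrite -/n -natr1 => n2.
  have th1 : `|t / lambda ^+ 2 - n%:R| <= 1 by rewrite ler_norml; lra.
  have ac : `|a - c| <= 1 + `|c| by rewrite (le_trans (ler_normB _ _)) // lerD2r.
  have lB : lambda ^+ 2 * B <= e.
    by rewrite -ler_pdivlMr // (le_trans _ (ltW le)) // expr2 ger_pMl // ltW.
  have w0 : 0 < lambda ^+ 2 / t by rewrite divr_gt0.
  rewrite normrM [`|2 * _|]normrM [`|2|]ger0_norm //.
  rewrite [`|lambda ^+ 2 / t * _|]normrM (gtr0_norm w0) [`|_ * (a - c)|]normrM.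
  apply: le_trans lB.
  apply: (@le_trans _ _ (2 * `|l 0 i| * (lambda ^+ 2 / t * (1 * (1 + `|c|))))).
    apply: ler_wpM2l; first by rewrite mulr_ge0.
    by apply: ler_wpM2l; [exact: ltW | exact: ler_pM].
  rewrite /B [leRHS]mulrDr mulr1 
    [leLHS](_ : _ = lambda ^+ 2 * (2 * `|l 0 i| * (1 + `|c|) / t)).
    by rewrite lerDl ltW.
  by field; rewrite gt_eqF.
have cvFG : 2 * l 0 i * F lambda + 2 * l 0 i * c + G lambda
    @[lambda --> 0^'+] --> 2 * c * l 0 i.
  rewrite [X in _ --> X](_ : _ = 2 * l 0 i * 0 + 2 * l 0 i * c + 0); last by ring.
  by apply: cvgD => //; apply: cvgD; [exact: cvgMr | exact: cvg_cst].
apply: cvg_trans cvFG; apply: near_eq_cvg; near=> lambda.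
have l0 : 0 < lambda by [].
have l1 : lambda < 1 by near: lambda; exact: nbhs_right_lt.
have lam : 0 < lambda < 1 by rewrite l0.
rewrite (vexpectation_velocity i wb l0 t0 (hq _ lam)) -/u /F /G.
set n := Num.truncn _; set a := iter _ _ _ _.
have -> : walk_psum (perturb lambda l w) n u 0 =
    walk_psum (perturb lambda l w) n (fun x => u x - c) 0 + n%:R * c.
  have -> : u = (fun x => u x - c) \+ cst c by apply/funext => x /=; rewrite subrK.
  rewrite psumD /= psum_cst //; congr (psum _ _ _ _ _ + _).
  by apply/funext => x; rewrite /= addrK.
rewrite -[psum (tilt _ _ _) _ _ _ _]/(walk_psum (perturb lambda l w) n (fun x => u x - c) 0).
by field; rewrite !gt_eqF.
Unshelve. all: by end_near. Qed.

End velocity.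

Theorem theorem1p7 (R : realType) (d : nat) (hd : (2 <= d)%N)
    (P : probability (env R d) R)
    (hiid : iid P) (hbal : balanced P) (hell : uniformly_elliptic P)
    (Q : probability (env R d) R)
    (hinv : env_invariant Q) (herg : env_ergodic Q)
    (hQP : Q `<< P) (hPQ : P `<< Q)
    (l : 'rV[R]_d) (hl : \sum_i l 0 i ^+ 2 = 1) :
  {ae P, forall w : env R d,
    forall t : R, 1 <= t ->
    forall Pw : R -> probability (trajectory d) R,
      (forall lambda : R, 0 < lambda < 1 ->
         quenched_law (perturb lambda l w) 0 (Pw lambda)) ->
      vexpectation (Pw lambda)
        (fun X => (t / lambda)^-1 *: interp X (t / lambda ^+ 2))
        @[lambda --> 0^'+] --> D_ell Q l}.
Proof.
(* Since [P] is absolutely continuous with respect to [Q], the ergodic limits proved under [Q] hold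
   [P]-almost everywhere. *)
have QP A : {ae Q, forall w, A w} -> {ae P, forall w, A w}.
  move=> [N [mN QN subN]]; exists N; split => //.
  by move/null_content_dominatesP : hPQ; apply.
pose f i (w : env R d) := weight w 0 (Some (i, true)).
have bf i : bounded_measurable (f i) := bounded_measurable_weight 0 (Some (i, true)).
pose c i := \int[Q]_w f i w.
(* These limits involve the unperturbed walk only, so the exceptional set depends neither on [t] nor
   on [lambda] nor on the laws [Pw]. *)
have ae_i : {ae P, forall w i, exists2 I : nat -> R, I m @[m --> \oo] --> 0 &
  forall m, walk_psum (weight w) n (fun y => (walk_psum (weight w) m
      (fun x => weight w x (Some (i, true)) - c i) y / m%:R) ^+ 2) 0 / n%:R
    @[n --> \oo] --> I m}.
  apply: filter_forall => i; apply: QP.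
  have bc : bounded_measurable (cst (- c i) : env R d -> R) := bounded_measurable_cst _.
  have bg : bounded_measurable (f i \+ cst (- c i)).
    exact: bounded_measurableD (bf i) bc.
  have g0 : \int[Q]_w (f i \+ cst (- c i)) w = 0.
    rewrite RintegralD //; try exact: bounded_measurable_integrable.
    by rewrite Rintegral_probability_cst subrr.
  have [I I0 aeI] := ae_average_square hinv herg bg g0.
  apply: filterS aeI => w H; exists I => // m; have := H m.
  rewrite (_ : (fun y => (f i \+ cst (- c i)) (shift y w)) =
    fun x => weight w x (Some (i, true)) - c i) //.
  by apply/funext => x; rewrite /= /f /weight /shift add0r.
apply: filterS2 (ae_balanced hbal) ae_i => w wb ae_i t t1 Pw hq.
apply: cvg_row => i; rewrite mxE (_ : fine _ = c i); last by rewrite unlock.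
have [I I0 cvI] := ae_i i.
exact: cvg_velocity hl wb (lt_le_trans ltr01 t1) hq cvI I0.
Qed.
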